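(* Let $(X,d)$ be a (nonempty) complete metric space, let $\psi,\phi:(0,\infty)\to\mathbb{R}$ be functions, and let $w:X\to X$ be a continuous map such that $$\psi(d(w(x),w(y)))\le\phi(d(x,y))\quad\text{for all }x,y\in X\text{ with }d(w(x),w(y))>0.$$ Suppose that: (i) $\psi$ and $\phi$ are nondecreasing; (ii) $\phi(t)<\psi(t)$ for any $t>0$; (iii) $\limsup_{t\to\epsilon+}\phi(t)<\psi(\epsilon+)$ for any $\epsilon>0$. Then there exists a unique attractor $A^*\in\mathcal{H}(X)$ for $w$, i.e. a unique $A^*\in\mathcal{H}(X)$ with $w(A^* )=A^*$. Moreover, for any $A\in\mathcal{H}(X)$ the sequence $\{A_n\}$ in $\mathcal{H}(X)$ given by $A_n=w^n(A)$ converges to $A^*$ in $(\mathcal{H}(X),h_d)$.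
   Context: $\mathcal{H}(X)$ is the set of all nonempty compact subsets of $X$, with the Hausdorff metric $h_d(A,B)=\max\{\max_{x\in A}\min_{y\in B}d(x,y),\ \max_{x\in B}\min_{y\in A}d(x,y)\}$. For $A\subseteq X$, $w(A)=\{w(a):a\in A\}$, and $w^n(A)$ is the image of $A$ under the $n$-fold composition of $w$. $\psi(\epsilon+)$ denotes the right-hand limit of $\psi$ at $\epsilon$. *)

(* Defs.v *)
From HB Require Import structures.
From mathcomp Require Import all_boot all_order all_algebra.
From mathcomp Require Import all_classical all_reals all_analysis.

Set Implicit Arguments.
Unset Strict Implicit.
Unset Printing Implicit Defensive.

Import Order.TTheory GRing.Theory Num.Theory.
Import numFieldNormedType.Exports.

Local Open Scope classical_set_scope.
Local Open Scope ring_scope.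

(* As for every complete space of the library, the structure is pointed, which
   makes the space nonempty. *)
#[short(type="completeMetricType")]
HB.structure Definition CompleteMetric (R : numDomainType) :=
  { T of CompletePseudoMetric R T & PseudoMetric_isMetric R T }.

Record hyperspace (X : topologicalType) := Hyperspace {
  hyperset :> set X;
  hyperset_neq0 : hyperset !=set0;
  hyperset_compact : compact hyperset }.
Arguments hyperset_compact {X} h : rename.

HB.instance Definition _ (X : topologicalType) :=
  gen_eqMixin (hyperspace X).
HB.instance Definition _ (X : topologicalType) :=
  gen_choiceMixin (hyperspace X).

Lemma hyperspaceP (X : topologicalType) (A B : hyperspace X) :
  A = B :> set X -> A = B.
Proof.
case: A B => [A A0 cA] [B B0 cB] /= AB; move: A0 cA; rewrite {}AB => A0 cA.
by congr Hyperspace; exact: Prop_irrelevance.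
Qed.

Section hausdorff_distance.
Context {R : realType} {X : metricType R}.
Implicit Types (x y : X) (A B C : set X).

(* The infima and suprema below are attained when A and B are compact and
   nonempty: see [point_dist_attained] and [excess_attained]. *)
Definition point_dist x B : R := inf [set mdist x y | y in B].

Definition excess A B : R := sup [set point_dist x B | x in A].

Definition hausdorff_dist A B : R := Num.max (excess A B) (excess B A).

Lemma mdist_dist_le x y z : `|mdist x z - mdist y z| <= mdist x y.
Proof.
rewrite ler_norml lerBlDr metric_triangle andbT.
by rewrite lerNl opprB lerBlDr (metric_sym x y) metric_triangle.
Qed.

Lemma lipschitz1_continuous (f : X -> R) :
  (forall x y, `|f x - f y| <= mdist x y) -> continuous f.
Proof.
move=> lf x; apply/cvgrPdist_lt => e e0.
apply/metricType_numDomainType.nbhs_mdistP; exists e => //= y xye.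
exact: le_lt_trans (lf x y) xye.
Qed.

Lemma point_dist_attained x B : B !=set0 -> compact B ->
  exists2 y, B y &
    point_dist x B = mdist x y /\ forall z, B z -> mdist x y <= mdist x z.
Proof.
move=> B0 cB.
have cf : {within B, continuous (fun y => mdist x y)}.
  apply: continuous_subspaceT; apply: lipschitz1_continuous => y z.
  by rewrite (metric_sym x y) (metric_sym x z) mdist_dist_le.
have [y /set_mem By ymin] := compact_EVT_min B0 cB cf.
have {}ymin z : B z -> mdist x y <= mdist x z by move=> /mem_set/ymin.
exists y => //; split=> //; apply/eqP; rewrite eq_le; apply/andP; split.
  apply: ge_inf; last by exists y.
  by exists (mdist x y) => _ [z Bz <-]; exact: ymin.
apply: lb_le_inf; first by exists (mdist x y), y.
by move=> _ [z Bz <-]; exact: ymin.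
Qed.

Lemma point_dist_le x y B : B !=set0 -> compact B -> B y ->
  point_dist x B <= mdist x y.
Proof.
by move=> B0 cB By; have [z _ [-> /(_ _ By)]] := point_dist_attained x B0 cB.
Qed.

Lemma excess_attained A B :
  A !=set0 -> compact A -> B !=set0 -> compact B ->
  exists2 x, A x & excess A B = point_dist x B /\
    forall z, A z -> point_dist z B <= point_dist x B.
Proof.
move=> A0 cA B0 cB.
have le1 x y : point_dist x B - point_dist y B <= mdist x y.
  have [z Bz [-> _]] := point_dist_attained y B0 cB.
  rewrite lerBlDr (le_trans (point_dist_le x B0 cB Bz))//.
  exact: metric_triangle.
have cf : {within A, continuous (fun x => point_dist x B)}.
  apply: continuous_subspaceT; apply: lipschitz1_continuous => x y.
  by rewrite ler_norml le1 andbT lerNl opprB metric_sym le1.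
have [x /set_mem Ax xmax] := compact_EVT_max A0 cA cf.
have {}xmax z : A z -> point_dist z B <= point_dist x B by move=> /mem_set/xmax.
exists x => //; split=> //; apply/eqP; rewrite eq_le; apply/andP; split.
  apply: ge_sup; first by exists (point_dist x B), x.
  by move=> _ [z Az <-]; exact: xmax.
apply: ub_le_sup; last by exists x.
by exists (point_dist x B) => _ [z Az <-]; exact: xmax.
Qed.

End hausdorff_distance.

Section hyperspace_metric.
Context {R : realType} {X : metricType R}.
Implicit Types A B C : hyperspace X.

Let excessP A B : exists2 x, hyperset A x & excess A B = point_dist x B /\
  forall z, hyperset A z -> point_dist z B <= point_dist x B.
Proof.
by apply: excess_attained; solve [exact: hyperset_neq0|exact: hyperset_compact].
Qed.

Let pdistP x B : exists2 y, hyperset B y & point_dist x B = mdist x y /\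
  forall z, hyperset B z -> mdist x y <= mdist x z.
Proof.
by apply: point_dist_attained; [exact: hyperset_neq0|exact: hyperset_compact].
Qed.

Let excess_ge0 A B : 0 <= excess A B.
Proof.
by have [x _ [-> _]] := excessP A B; have [y _ [-> _]] := pdistP x B;
  exact: mdist_ge0.
Qed.

Let excess_exists A B x : hyperset A x ->
  exists2 y, hyperset B y & mdist x y <= excess A B.
Proof.
move=> Ax; have [a _ [-> /(_ _ Ax)]] := excessP A B.
by have [y By [-> _]] := pdistP x B; exists y.
Qed.

Let excess_le A B e :
  (forall x, hyperset A x -> exists2 y, hyperset B y & mdist x y <= e) ->
  excess A B <= e.
Proof.
move=> ABe; have [x Ax [-> _]] := excessP A B.
have [y By xye] := ABe x Ax; apply: le_trans xye.
by have [z _ [-> /(_ _ By)]] := pdistP x B.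
Qed.

Let excess_triangle A B C : excess A C <= excess A B + excess B C.
Proof.
apply: excess_le => x Ax; have [y By xy] := excess_exists B Ax.
have [z Cz yz] := excess_exists C By; exists z => //.
by rewrite (le_trans (metric_triangle x y z))// lerD.
Qed.

Let hdistxx A : hausdorff_dist A A = 0.
Proof.
rewrite /hausdorff_dist maxxx; apply/eqP; rewrite eq_le excess_ge0 andbT.
by apply: excess_le => x Ax; exists x => //; rewrite mdistxx.
Qed.

Let hdist_positivity A B : hausdorff_dist A B = 0 -> A = B.
Proof.
move=> AB0; have: hausdorff_dist A B <= 0 by rewrite AB0.
rewrite ge_max => /andP[AB BA]; apply: hyperspaceP.
have sub (C D : hyperspace X) : excess C D <= 0 -> hyperset C `<=` D.
  move=> CD x Cx; have [y Dy xy] := excess_exists D Cx.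
  suff -> : x = y by [].
  by apply: mdist_positivity; apply/eqP;
    rewrite eq_le mdist_ge0 andbT (le_trans xy).
by apply/seteqP; split; exact: sub.
Qed.

Let hdist_sym A B : hausdorff_dist A B = hausdorff_dist B A.
Proof. by rewrite /hausdorff_dist maxC. Qed.

Let hdist_triangle B A C :
  hausdorff_dist A C <= hausdorff_dist A B + hausdorff_dist B C.
Proof.
rewrite ge_max; apply/andP; split.
  by rewrite (le_trans (excess_triangle A B C))// lerD// le_max lexx.
rewrite (le_trans (excess_triangle C B A))// addrC.
by rewrite lerD// le_max lexx orbT.
Qed.

HB.instance Definition _ := isMetric.Build R (hyperspace X)
  hdistxx hdist_positivity hdist_sym hdist_triangle.

End hyperspace_metric.

Section hyperspace_map.
Context {X Y : topologicalType} {f : X -> Y} (cf : continuous f).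

Lemma hyper_image_neq0 (A : hyperspace X) : f @` A !=set0.
Proof. by have [x Ax] := hyperset_neq0 A; exists (f x), x. Qed.

Lemma hyper_image_compact (A : hyperspace X) : compact (f @` A).
Proof.
apply: continuous_compact; last exact: hyperset_compact.
exact: continuous_subspaceT.
Qed.

Definition hyper_image (A : hyperspace X) : hyperspace Y :=
  Hyperspace (hyper_image_neq0 A) (@hyper_image_compact A).

End hyperspace_map.

Lemma continuous_iter {X : topologicalType} {f : X -> X} (cf : continuous f)
  (n : nat) : continuous (iter n f).
Proof.
elim: n => [|n IHn] x /=; first exact: cvg_id.
by apply: continuous_comp; [exact: IHn|exact: cf].
Qed.
Arguments continuous_iter {X f} cf n.

(* Main.v *)
Require Import Defs.
From mathcomp Require Import all_boot all_order all_algebra.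
From mathcomp Require Import all_classical all_reals all_analysis.

(* Monotonicity and (iii) make w a contraction of Meir-Keeler type: points at
   distance slightly more than e are mapped to points at distance at most e, and
   w strictly decreases positive distances. Such a map has a fixed point p, so
   the attractor is {p}. On compact sets the distance to {p} is a maximum of
   distances to p, hence the map A |-> w(A) satisfies the same two conditions
   with respect to {p}, which yields convergence of w^n(A) to {p}; uniqueness
   follows since a set with w(A) = A gives a constant sequence. *)

Set Implicit Arguments.
Unset Strict Implicit.
Unset Printing Implicit Defensive.

Import Order.TTheory GRing.Theory Num.Theory.
Import numFieldNormedType.Exports.

Local Open Scope classical_set_scope.
Local Open Scope ring_scope.

(** Unlike in the usual Meir-Keeler condition, [mdist x y] has no lower bound [e], and the bound on
    the images is not strict; strict decrease is the separate [strictly_contractive]. *)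
Definition meir_keeler (R : realType) (X : metricType R) (w : X -> X) :=
  forall e : R, 0 < e -> exists2 d : R, 0 < d &
    forall x y, mdist x y < e + d -> mdist (w x) (w y) <= e.

Definition strictly_contractive (R : realType) (X : metricType R)
    (w : X -> X) :=
  forall x y, 0 < mdist (w x) (w y) -> mdist (w x) (w y) < mdist x y.

(** Being nonincreasing, [u] tends to its infimum L. If L > 0, some [u n] is below L + d, so
    [u n.+1] is at most L and the strict decrease puts [u n.+2] below L, which is absurd. *)
Lemma meir_keeler_seq_cvg0 (R : realType) (u : nat -> R) :
    (forall n, 0 <= u n) ->
    (forall n, 0 < u n.+1 -> u n.+1 < u n) ->
    (forall e, 0 < e -> exists2 d, 0 < d &
      forall n, u n < e + d -> u n.+1 <= e) ->
  u @ \oo --> 0.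
Proof.
move=> u0 ult umk.
have uni : nonincreasing_seq u.
  apply/nonincreasing_seqP => n.
  by have [/ult/ltW//|un0] := ltP 0 (u n.+1); exact: le_trans (u0 n).
have ulb : has_lbound (range u) by exists 0 => _ [n _ <-].
have Lle n : inf (range u) <= u n by apply: ge_inf => //; exists n.
suff <- : inf (range u) = 0 by exact: nonincreasing_cvgn.
apply/eqP; rewrite eq_le lb_le_inf ?andbT; last 2 first.
- by exists (u 0%N), 0%N.
- by move=> _ [n _ <-].
rewrite leNgt; apply/negP => L0.
have [d d0 /= dP] := umk _ L0.
have [|_ [n _ <-] /dP unL] := @inf_adherent _ (range u) _ d0.
  by split=> //; exists (u 0%N), 0%N.
have /ult : 0 < u n.+2 by exact: lt_le_trans (Lle _).
by rewrite ltNge (le_trans unL).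
Qed.

Lemma meir_keeler_fixpoint (R : realType) (X : completeMetricType R)
    (w : X -> X) :
    continuous w -> strictly_contractive w -> meir_keeler w ->
  exists p, w p = p.
Proof.
move=> wc wlt wmk; pose x n := iter n w (point : X).
have step0 : (fun n => mdist (x n) (x n.+1)) @ \oo --> (0 : R).
  apply: meir_keeler_seq_cvg0 => [n|n|e /wmk[d d0 dP]].
  - exact: mdist_ge0.
  - exact: wlt.
  - by exists d => // n; exact: dP.
have : cvg (x @ \oo).
  apply: cauchy_cvg; apply: cauchy_exP => e e0.
  have e20 : 0 < e / 2 by rewrite divr_gt0.
  have [d d0 dP] := wmk _ e20.
  have m0 : 0 < Num.min d (e / 2) by rewrite lt_min d0.
  have /cvgrPdist_lt/(_ _ m0)[N _ NP] := step0.
  have {NP}: mdist (x N) (x N.+1) < Num.min d (e / 2).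
    by have := NP N (leqnn N); rewrite sub0r normrN ger0_norm// mdist_ge0.
  set m := Num.min _ _ in m0 *.
  (* The orbit is trapped near [x N]: since m <= d, [w] maps a point within e/2 + m of [x N] to one
     within e/2 of [x N.+1], and the step from [x N] to [x N.+1] costs less than m. As m <= e/2, the
     radius is at most e. *)
  move=> NP; have stay k : mdist (x N) (x (N + k)%N) < e / 2 + m.
    elim: k => [|k IHk]; first by rewrite addn0 mdistxx addr_gt0.
    rewrite addnS (le_lt_trans (metric_triangle _ (x N.+1) _))//.
    rewrite addrC ler_ltD//; apply: dP; apply: lt_le_trans IHk _.
    by rewrite lerD2l ge_min lexx.
  exists (x N); exists N => //= n Nn; rewrite ballEmdist/=.
  rewrite -(subnKC Nn) (lt_le_trans (stay _))// [leRHS]splitr lerD2l.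
  by rewrite ge_min lexx orbT.
move=> /cvg_ex[p xp]; exists p.
have xwp : x @ \oo --> w p.
  by rewrite -cvg_shiftS; apply: (@cvg_comp _ _ _ x w); [exact: xp|exact: wc].
exact: (cvg_unique (@metric_hausdorff _ X) xwp xp).
Qed.

Section contraction_toward_fixpoint.
Context {R : realType} {X : metricType R}.

Lemma set1_nonempty (p : X) : [set p] !=set0.
Proof. by exists p. Qed.

Definition hyper_set1 (p : X) : hyperspace X :=
  Hyperspace (set1_nonempty p) (compact_set1 (x := p)).

Lemma point_dist_set1 (a p : X) : point_dist a [set p] = mdist a p.
Proof.
by have [_ -> [->]] := point_dist_attained a (set1_nonempty p)
  (compact_set1 (x := p)).
Qed.

Lemma mdist_hyper_set1 (A : hyperspace X) (p : X) :
  exists a, [/\ hyperset A a, mdist A (hyper_set1 p) = mdist a p &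
    forall b, hyperset A b -> mdist b p <= mdist a p].
Proof.
have [a Aa [exA amax]] := excess_attained (hyperset_neq0 A)
  (hyperset_compact A) (set1_nonempty p) (compact_set1 (x := p)).
rewrite point_dist_set1 in exA amax.
exists a; split=> //[|b /amax]; last by rewrite point_dist_set1.
(* The other excess is the distance from [p] to a nearest point of [A], hence at most the distance
   to [a]. *)
rewrite [LHS]/mdist/= /hausdorff_dist exA; apply/max_idPl.
have [_ -> [-> _]] := excess_attained (set1_nonempty p)
  (compact_set1 (x := p)) (hyperset_neq0 A) (hyperset_compact A).
rewrite (metric_sym a); apply: point_dist_le => //.
- exact: hyperset_neq0.
- exact: hyperset_compact.
Qed.

(** Stated for any sequence obeying the recursion, so that it covers both the iterates of a set and
    the constant sequence of an invariant set. *)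
Lemma hyper_iter_cvg_fixpoint (w : X -> X) (p : X) (An : nat -> hyperspace X) :
    strictly_contractive w -> meir_keeler w -> w p = p ->
    (forall n, w @` An n = An n.+1) ->
  An @ \oo --> hyper_set1 p.
Proof.
move=> wlt wmk wp wAn.
(* A point of [An n.+1] farthest from [p] has a preimage [b] in [An n]; the conditions on [w] are
   then used at the pair [b], [p]. *)
have pred n : exists2 b, mdist b p <= mdist (An n) (hyper_set1 p) &
    mdist (An n.+1) (hyper_set1 p) = mdist (w b) (w p).
  have [a []] := mdist_hyper_set1 (An n.+1) p.
  rewrite -wAn => -[b Anb <-] -> _; exists b; last by rewrite wp.
  by have [c [_ -> ]] := mdist_hyper_set1 (An n) p; exact.
have dist0 : (fun n => mdist (An n) (hyper_set1 p)) @ \oo --> (0 : R).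
  apply: meir_keeler_seq_cvg0 => [n|n|e /wmk[d d0 dP]].
  - exact: mdist_ge0.
  - by have [b bn ->] := pred n => /wlt wb; exact: lt_le_trans bn.
  - exists d => // n; have [b bn ->] := pred n => nd.
    by apply: dP; exact: le_lt_trans nd.
apply/metricType_numDomainType.cvgrPdist_lt => e e0.
have /cvgrPdist_lt/(_ _ e0) := dist0.
apply: filterS => n; rewrite sub0r normrN ger0_norm ?mdist_ge0//.
by rewrite metric_sym.
Qed.

End contraction_toward_fixpoint.

Section psi_phi_contraction.
Context {R : realType} {X : metricType R} (psi phi : R -> R) (w : X -> X).
Context (wcontr : forall x y : X, 0 < mdist (w x) (w y) ->
  psi (mdist (w x) (w y)) <= phi (mdist x y)).
Context (psi_nd : forall s t : R, 0 < s -> s <= t -> psi s <= psi t).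
Context (phi_lt_psi : forall t : R, 0 < t -> phi t < psi t).

(** If t = d(x,y) were at most s = d(w x, w y), then phi t < psi t <= psi s <= phi t. *)
Lemma psi_phi_strictly_contractive : strictly_contractive w.
Proof.
move=> x y wxy0; rewrite ltNge; apply/negP => le_w.
have xy0 : 0 < mdist x y.
  by move: wxy0; rewrite !mdist_gt0; apply: contraNneq => ->.
have := lt_le_trans (phi_lt_psi xy0) (psi_nd xy0 le_w).
by rewrite ltNge wcontr.
Qed.

Lemma lim_right_le (e s : R) : 0 < e -> e < s ->
  lim (psi t @[t --> e^'+]) <= psi s.
Proof.
move=> e0 es; apply: limr_le.
  (* [lim] is meaningful only if the limit exists: to the right of [e], [psi] is monotone and
     bounded below by [psi e]. *)
  apply: nondecreasing_at_right_is_cvgr; apply: nearW => b.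
    move=> r t; rewrite !in_itv/= => /andP[er _] _.
    by apply: psi_nd; exact: lt_trans er.
  exists (psi e) => _ [r /= + <-]; rewrite in_itv/= => /andP[/ltW er _].
  exact: psi_nd.
near=> t; apply: psi_nd; last by near: t; exact: nbhs_right_le.
by apply: (lt_trans e0); near: t; exact: nbhs_right_gt.
Unshelve. all: by end_near. Qed.

(** Otherwise e < d(w x, w y) < d(x,y) < e + d, and psi(e+) <= psi(d(w x, w y)) <= phi(d(x,y)) <
    psi(e+), the last because d is chosen so that the supremum of phi over (e, e + d) is below
    psi(e+). *)
Lemma psi_phi_meir_keeler :
    (forall eps : R, 0 < eps ->
      (limf_esup (EFin \o phi) eps^'+ < (lim (psi t @[t --> eps^'+]))%:E)%E) ->
  meir_keeler w.
Proof.
move=> limsup_lt e e0.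
have := limsup_lt _ e0; rewrite limf_esupE => /ereal_inf_lt[_ [V Ve <-] Vlt].
have [d /= d0 dV] := Ve.
exists d => // x y xyd; rewrite leNgt; apply/negP => ewxy.
have wxy0 := lt_trans e0 ewxy.
have exy := lt_trans ewxy (psi_phi_strictly_contractive wxy0).
have Vxy : V (mdist x y).
  apply: dV => //=; rewrite distrC ger0_norm ?subr_ge0 ?ltW//.
  by rewrite ltrBlDl.
have : phi (mdist x y) < lim (psi t @[t --> e^'+]).
  rewrite -lte_fin; apply: le_lt_trans Vlt; apply: ereal_sup_ubound.
  by exists (mdist x y).
by rewrite ltNge (le_trans (lim_right_le e0 ewxy))// wcontr.
Qed.

End psi_phi_contraction.

Theorem theorem4p1 (R : realType) (X : completeMetricType R)
    (psi phi : R -> R) (w : X -> X) (wcont : continuous w)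
    (wcontr : forall x y : X, 0 < mdist (w x) (w y) ->
      psi (mdist (w x) (w y)) <= phi (mdist x y))
    (psi_nd : forall s t : R, 0 < s -> s <= t -> psi s <= psi t)
    (phi_nd : forall s t : R, 0 < s -> s <= t -> phi s <= phi t)
    (phi_lt_psi : forall t : R, 0 < t -> phi t < psi t)
    (limsup_lt : forall eps : R, 0 < eps ->
      (limf_esup (EFin \o phi) eps^'+ < (lim (psi t @[t --> eps^'+]))%:E)%E) :
  exists Astar : hyperspace X,
    [/\ w @` Astar = Astar,
        (forall B : hyperspace X, w @` B = B -> B = Astar) &
        forall A : hyperspace X,
          hyper_image (continuous_iter wcont n) A @[n --> \oo] --> Astar].
Proof.
have wlt : strictly_contractive w by exact: (psi_phi_strictly_contractive wcontr).
have wmk : meir_keeler w by exact: (psi_phi_meir_keeler wcontr).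
have [p wp] := meir_keeler_fixpoint wcont wlt wmk.
exists (hyper_set1 p); split=> [|B wB|A].
- by rewrite /= image_set1 wp.
- have Bp : (fun=> B) @ \oo --> hyper_set1 p.
    exact: (@hyper_iter_cvg_fixpoint _ _ w p (fun=> B)).
  apply: (cvg_unique (@metric_hausdorff _ (hyperspace X)) _ Bp).
  exact: cvg_cst.
- apply: (hyper_iter_cvg_fixpoint wlt wmk wp) => n /=.
  by rewrite image_comp.
Qed.
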